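(* Let $d\ge1$ be an integer and $p\in[0,1]$. There is a modified version of $\mathrm{RFM}(d+1,p)$ with frogs removed early that can be coupled with $\mathrm{RFM}(d,p)$ so that recurrence is equivalent in both models, i.e. $\mathrm{RFM}(d,p)$ is recurrent if and only if the modified version of $\mathrm{RFM}(d+1,p)$ is recurrent.
   Context: $\mathbb T_d$ is the rooted $d$-ary tree: the infinite tree in which every vertex has exactly $d$ children, with root $\varnothing$. The recursive frog model $\mathrm{RFM}(d,p)$, $p\in[0,1]$: put $\rho=p/(1-p)$ if $p<1/2$ and $\rho=1$ if $p\ge 1/2$. Initially there is one awake frog at the root and one sleeping frog at each non-root vertex of $\mathbb T_d$. At each discrete time step one frog is sampled uniformly from the set of awake (not removed) frogs and performs one step. The initially awake frog at the root moves to a uniformly sampled child at its first step. Any other awake frog that has so far not moved away from the root moves, independently of everything else, to the parent of its current vertex with probability $\rho$, and with probability $1-\rho$ moves away from the root. Moving away from the root always means moving to a uniformly sampled child vertex of the current vertex (possibly the vertex from which the frog just came). Once a frog has moved away from the root, at all of its later steps it continues to move away from the root to a uniformly sampled child. A frog that reaches the root (by moving to it) is removed. A frog that moves away from the root and lands on a site that has already been visited by an awake frog is removed. Whenever an awake frog lands on a site with a sleeping frog, that sleeping frog wakes up and begins its own independent motion according to these rules. The process (or a modification of it) is recurrent if the total number of visits (arrivals) of frogs at the root is infinite almost surely. Removed early: a frog is removed early if it is killed before the killing rule of the recursive frog model (removal at the root, or upon moving away from the root onto an already-visited site) would have killed it, if ever. A modified version of $\mathrm{RFM}(d+1,p)$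 with frogs removed early is a process whose law is obtained by following the rules of $\mathrm{RFM}(d+1,p)$ except that frogs may additionally be removed early. The decision to remove may depend on the history of the process so far, including the step currently being attempted, and on additional randomness, but not on the future moves. A frog may be killed during a step, after its destination is chosen but before arriving, in which case the destination is not visited and no frog is woken there by that step. *)

(* Defs.v *)
(* MathComp world: MathComp, finmap and MathComp-Analysis. *)
From mathcomp Require Export all_boot all_order all_algebra.
From mathcomp Require Export finmap.
From mathcomp Require Export all_classical all_reals all_analysis.
Set Implicit Arguments.
Unset Strict Implicit.
Unset Printing Implicit Defensive.
Import Order.TTheory GRing.Theory Num.Theory.
Local Open Scope classical_set_scope.
Local Open Scope ring_scope.

(* A vertex of the rooted d-ary tree is the list of child labels on its path
   to the root, deepest label first: the i-th child of x is i :: x, the parent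
   of x is behead x, and the root is the empty list.  There is exactly one frog
   per vertex, so a frog is named by the vertex it starts from. *)
Notation vertex d := (seq 'I_d).

(* The boolean records whether the frog has to move away from the root at
   every later step. *)
Inductive frog_state (d : nat) :=
  | Awake of vertex d & bool
  | Removed.
Arguments Removed {d}.

Definition is_awake d (s : frog_state d) : bool :=
  if s is Awake _ _ then true else false.

(* Frogs outside the domain of [frogs] are sleeping at their own vertex. *)
Record config (d : nat) := Config {
  frogs : {fmap vertex d -> frog_state d};
  visited : {fset vertex d}
}.

(* The flag of the initial frog is set from the start because its first step
   is always to a child of the root. *)
Definition init_config d : config d :=
  Config [fmap].[[::] <- Awake [::] true]%fmap [fset [::]]%fset.

Definition awake d (c : config d) : {fset vertex d} :=
  [fset v in domf (frogs c) |
     if (frogs c).[? v]%fmap is Some s then is_awake s else false]%fset.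

(* None is a step to the parent, Some i a step to the i-th child. *)
Definition destination d (x : vertex d) (m : option 'I_d) : vertex d :=
  if m is Some i then i :: x else behead x.

(* A sampled frog together with its move; None if no frog is awake. *)
Notation attempt_type d := (option (vertex d * option 'I_d)).

Definition remove_frogs d (S : {fset vertex d}) (c : config d) : config d :=
  Config (catf (frogs c) [fmap _ : S => Removed]%fmap) (visited c).

Definition wake d (y : vertex d) (f : {fmap vertex d -> frog_state d}) :
    {fmap vertex d -> frog_state d} :=
  if y \in domf f then f else f.[y <- Awake y false]%fmap.

(* [killed] tells whether the moving frog is killed after its destination is
   chosen and before it arrives there. *)
Definition advance d (a : attempt_type d) (killed : bool) (c : config d) :
    config d :=
  if a is Some (v, m) then
    if (frogs c).[? v]%fmap is Some (Awake x away) then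
      let y := destination x m in
      if killed then Config (frogs c).[v <- Removed]%fmap (visited c)
      else
        let moved :=
          if (y == [::]) || (isSome m && (y \in visited c)) then Removed
          else Awake y (away || isSome m) in
        Config (wake y (frogs c)).[v <- moved]%fmap (y |` visited c)%fset
    else c
  else c.

Definition root_arrival d (a : attempt_type d) (killed : bool)
    (c : config d) : bool :=
  if a is Some (v, m) then
    if (frogs c).[? v]%fmap is Some (Awake x _) then
      ~~ killed && (destination x m == [::])
    else false
  else false.

Definition rho (R : realType) (p : R) : R :=
  if p < 1 / 2 then p / (1 - p) else 1.

Definition move_prob (R : realType) d (p : R) (away : bool)
    (m : option 'I_d) : R :=
  match m with
  | None => if away then 0 else rho p
  | Some _ => (if away then 1 else 1 - rho p) / d%:R
  end.

Definition attempt_prob (R : realType) d (p : R) (c : config d)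
    (a : attempt_type d) : R :=
  match a with
  | None => (awake c == fset0)%:R
  | Some (v, m) =>
      if (frogs c).[? v]%fmap is Some (Awake _ away) then
        #|` awake c|%:R^-1 * move_prob p away m
      else 0
  end.

(* In step n, the frogs of [culled n] are first removed early; then a frog is
   sampled and chooses its destination, giving [attempt n]; then the sampled
   frog is killed before arrival if [intercepted n] holds. *)
Record frog_process (d : nat) (T : Type) := FrogProcess {
  culled : nat -> T -> {fset vertex d};
  attempt : nat -> T -> attempt_type d;
  intercepted : nat -> T -> bool
}.

Section Process.
Variables (d : nat) (T : Type) (X : frog_process d T).

Fixpoint config_at (n : nat) (t : T) : config d :=
  if n is k.+1 then
    advance (attempt X k t) (intercepted X k t)
      (remove_frogs (culled X k t) (config_at k t))
  else init_config d.

Definition culled_config (n : nat) (t : T) : config d :=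
  remove_frogs (culled X n t) (config_at n t).

Definition root_arrival_at (n : nat) (t : T) : bool :=
  root_arrival (attempt X n t) (intercepted X n t) (culled_config n t).

End Process.

(* F n contains the history before step n and all additional randomness
   available by then.  All the variables involved are countably valued, so
   measurability and conditional laws given F n are expressed atom by atom. *)
Definition is_modified_rfm (R : realType) (disp : measure_display)
    (T : measurableType disp) (P : probability T R) (d : nat) (p : R)
    (X : frog_process d T) : Prop :=
  exists F : nat -> set (set T),
    [/\ forall n, sigma_algebra setT (F n) /\ F n `<=` measurable,
        forall n, F n `<=` F n.+1,
        forall n S, F n [set t | culled X n t = S],
        (forall n a, F n.+1 [set t | attempt X n t = a]) /\
        (forall n b, F n.+1 [set t | intercepted X n t = b])
      & forall n (E : set T) (c : config d) (a : attempt_type d), F n E ->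
          P (E `&` [set t | culled_config X n t = c]
               `&` [set t | attempt X n t = a]) =
          ((attempt_prob p c a)%:E *
            P (E `&` [set t | culled_config X n t = c]))%E].

Definition is_rfm (R : realType) (disp : measure_display)
    (T : measurableType disp) (P : probability T R) (d : nat) (p : R)
    (X : frog_process d T) : Prop :=
  is_modified_rfm P p X /\
  forall n t, culled X n t = fset0 /\ intercepted X n t = false.

Definition recurrent (R : realType) (disp : measure_display)
    (T : measurableType disp) (P : probability T R) (d : nat)
    (X : frog_process d T) : Prop :=
  {ae P, forall t, infinite_set [set n | root_arrival_at X n t]}.

(* Main.v *)
Require Import Defs.
From HB Require Import structures.
From mathcomp Require Import fingroup perm measurable_realfun ring lra.
Set Implicit Arguments.
Unset Strict Implicit.
Unset Printing Implicit Defensive.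
Import Order.TTheory GRing.Theory Num.Theory.
Local Open Scope classical_set_scope.
Local Open Scope ring_scope.

(** The large tree is explored through a copy of the small tree that sits inside
    it and is adjusted while the two processes run.  Every vertex x of the small
    tree carries a permutation of the d+1 labels.  The image under it of the
    label [lift ord_max i] is the large label that stands for the i-th child of
    x, and the image of [ord_max] is the label of a spare child of the copy of x,
    kept unvisited.  This gives an injective map [embed] of trees.

    The sampled frog, at x, draws k uniformly from d+1 labels when it moves away
    from the root, and in any case an independent uniform label i among d.  The
    large frog follows the image of k.  If k stands for a small child, the small
    frog goes to that child; if k is the spare label, the small frog goes to its
    i-th child.  A small child is thus chosen with probability
    1/(d+1) + 1/(d+1) * 1/d = 1/d, so each frog moves by the law of its own model
    ([draw_marginal], [sum_small_move], [sum_relabelled_move]).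

    When the spare child is drawn and the i-th child of x has been visited, the
    small frog is removed by the rules of the model, and the large frog, on its
    way to an unvisited site, is intercepted.  When the i-th child of x is still
    unvisited, the labels of that child and of the spare child are exchanged, and
    the large frog has moved to the copy of the i-th child; nothing visited is
    moved by the exchange ([swap_spare_outside]), and the new spare child is
    unvisited.  So at every time the large configuration is the copy of the small
    one ([step_coupled]), frogs reach the root at the same times in both
    processes, and recurrence is the same event.

    The only early removals are these interceptions.  They are decided by the
    past and by the attempted step, which is what makes the large process a
    modified version of the model.

    The probability space is the interval [0, 1[ with Lebesgue measure.  A
    history of draws corresponds to a subinterval whose length is the probability
    of the history, obtained by cutting the interval of the shorter history in
    proportion to the weights of its possible continuations ([exists_draws]).
    The filtration is the one generated by the draws; as histories are countably
    many, conditional laws need only be compared on single histories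
    ([history_event_law]). *)

(** * Random sequences with finitely many continuations at each step *)

Section UnitInterval.
Variable R : realType.

Definition unit_interval_prob : set (measurableTypeR R) -> \bar R :=
  mrestr lebesgue_measure (measurable_itv `[(0 : R), 1[).

HB.instance Definition _ := Measure.on unit_interval_prob.

Let unit_interval_probT : unit_interval_prob setT = 1%:E.
Proof.
rewrite /unit_interval_prob /mrestr setTI lebesgue_measure_itv /= lte_fin.
by rewrite ltr01 sube0.
Qed.

HB.instance Definition _ := @Measure_isProbability.Build _ _ R
  unit_interval_prob unit_interval_probT.

(** Points outside [0, 1[ have measure zero, so S need only be known inside. *)
Lemma unit_interval_prob_itv (S : set R) (a w : R) :
    0 <= a -> 0 <= w -> a + w <= 1 ->
    (forall u, 0 <= u < 1 -> S u <-> a <= u < a + w) ->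
  unit_interval_prob S = w%:E.
Proof.
move=> a0 w0 aw1 SE; rewrite /unit_interval_prob /mrestr.
have -> : S `&` `[0, 1[ = [set` `[a, a + w[].
  apply/seteqP; split => u /=; rewrite !in_itv /=.
    by move=> [Su u01]; apply/SE.
  move=> uaw; have u01 : 0 <= u < 1.
    by case/andP: uaw => au ua; rewrite (le_trans a0 au) (lt_le_trans ua aw1).
  by split=> //; apply/SE.
rewrite lebesgue_measure_itv /= lte_fin ltrDl.
case: ltrP => [_|]; first by rewrite -EFinB [a + w]addrC addrK.
by move=> w0'; congr EFin; apply/le_anti; rewrite w0 w0'.
Qed.

End UnitInterval.

Section PickWeighted.
Variables (R : realType) (D : eqType).
Implicit Types (s : seq D) (q : D -> R) (x : R).

(** Inverse transform sampling: if x is uniform in [0, 1[ and the weights q of the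
    elements of s add up to 1, the picked element k has probability q k.  When x
    exceeds the total weight, the last element of s is picked, so that a nonempty
    s never yields the default k0. *)
Fixpoint pick_weighted (k0 : D) s q x : D :=
  if s is k :: s' then if x < q k then k else pick_weighted k s' q (x - q k) else k0.

Definition offset s q (k : D) : R := \sum_(j <- take (index k s) s) q j.

Lemma pick_weighted_mem k0 s q x : s != [::] -> pick_weighted k0 s q x \in s.
Proof.
case: s => // k s _ /=; case: ifP => _; first by rewrite inE eqxx.
elim: s k (x - q k) => [|k' s IH] k y /=; first by rewrite inE.
by rewrite inE; case: ifP => _; [rewrite inE eqxx orbT | rewrite IH orbT].
Qed.

Lemma offset_ge0 s q k : (forall j, 0 <= q j) -> 0 <= offset s q k.
Proof. by move=> q0; apply: sumr_ge0. Qed.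

Lemma offset_le s q k : (forall j, 0 <= q j) -> k \in s ->
  offset s q k + q k <= \sum_(j <- s) q j.
Proof.
move=> q0 ks.
rewrite -[in leRHS](cat_take_drop (index k s) s) big_cat /= lerD2l.
rewrite (drop_nth k) ?index_mem // nth_index // big_cons lerDl.
exact: sumr_ge0.
Qed.

(** The intervals of length q k, laid end to end in the order of s, cut up
    [0, sum of q[; the first index whose right end exceeds x is the one of the
    interval that contains x. *)
Lemma pick_weighted_eq k0 s q x k : (forall j, 0 <= q j) -> uniq s -> k \in s ->
    0 <= x < \sum_(j <- s) q j ->
  pick_weighted k0 s q x = k <-> offset s q k <= x < offset s q k + q k.
Proof.
move=> q0; elim: s k0 x => //= k1 s IH k0 x /andP[k1s us].
rewrite inE /offset /= eq_sym big_cons => ks /andP[x0 xs].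
case: eqVneq ks => [<- _|k1k /= ks].
  rewrite big_nil x0 add0r /=; case: ltrP => [//|qx]; split => // pk.
  have sn0 : s != [::].
    apply: contraTneq xs => ->; rewrite big_nil addr0 -leNgt //.
  by have := pick_weighted_mem k1 q (x - q k1) sn0; rewrite pk (negbTE k1s).
rewrite big_cons; have o0 := offset_ge0 s k q0; rewrite /offset in o0.
case: ltrP => xq.
  split; first by move=> e; move: k1k; rewrite e eqxx.
  by move=> /andP[/(le_lt_trans)]/(_ _ xq); rewrite -ltrBrDl subrr ltNge o0.
rewrite IH //; last by rewrite subr_ge0 xq ltrBlDl.
by rewrite /offset lerBrDl ltrBlDl addrA.
Qed.

Lemma measurable_pick_weighted k0 s q k :
  measurable [set x : R | pick_weighted k0 s q x = k].
Proof.
elim: s k0 => [|k1 s IH] k0 /=.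
  case: (eqVneq k0 k) => [->|/eqP nk].
    by rewrite (_ : [set _ | _] = setT) //; apply/seteqP; split.
  by rewrite (_ : [set _ | _] = set0) //; apply/seteqP; split.
rewrite (_ : [set _ | _] =
    (if k1 == k then [set` `]-oo, q k1[] else set0)
    `|` ([set` `[q k1, +oo[] `&`
         (fun x => x - q k1) @^-1` [set x | pick_weighted k1 s q x = k])).
  apply: measurableU; first by case: ifP.
  apply: measurableI => //; rewrite -[X in measurable X]setTI.
  have mf : measurable_fun setT (fun x : R => x - q k1) by exact: measurable_funB.
  exact: mf.
apply/seteqP; split => x /=; case: ltrP => xq.
- by move=> <-; left; rewrite eqxx /= in_itv.
- by move=> pk; right; rewrite in_itv /= xq.
- case=> [|[]]; first by case: eqP.
  by rewrite in_itv /= andbT leNgt xq.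
- by case=> [|[]//]; case: eqP => // _; rewrite /= in_itv /= ltNge xq.
Qed.

End PickWeighted.

(** Latest draw first, so that a new draw is a [cons]. *)
Fixpoint history (T D : Type) (draw : nat -> T -> D) (n : nat) (t : T) : seq D :=
  if n is m.+1 then draw m t :: history draw m t else [::].

Lemma size_history (T D : Type) (draw : nat -> T -> D) n t :
  size (history draw n t) = n.
Proof. by elim: n => //= n ->. Qed.

(** The conditional law of the next draw, given a history h, is q h on the
    finitely many elements of supp h.  It is stated for events [g (draw n)]
    rather than for single draws because the attempts of the two processes are
    functions of the draw. *)
Definition has_law (R : realType) (disp : measure_display)
    (T : measurableType disp) (P : probability T R) (D : eqType)
    (supp : seq D -> seq D) (q : seq D -> D -> R) (draw : nat -> T -> D) : Prop :=
  (forall n h, measurable [set t | history draw n t = h]) /\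
  forall n h (g : pred D),
    P ([set t | history draw n t = h] `&` [set t | g (draw n t)]) =
    ((\sum_(k <- supp h | g k) q h k)%:E * P [set t | history draw n t = h])%E.

Section Draws.
Variables (R : realType) (D : choiceType) (k0 : D).
Variables (supp : seq D -> seq D) (q : seq D -> D -> R).
Hypothesis supp_uniq : forall h, uniq (supp h).
Hypothesis q_ge0 : forall h k, 0 <= q h k.
Hypothesis q_sum1 : forall h, \sum_(k <- supp h) q h k = 1.

(** The points of [0, 1[ whose first draws form the history h are an interval
    of left end [cyl_left h] and length [cyl_width h]. *)
Fixpoint cyl_width (h : seq D) : R :=
  if h is k :: h' then cyl_width h' * q h' k else 1.

Fixpoint cyl_left (h : seq D) : R :=
  if h is k :: h' then cyl_left h' + cyl_width h' * offset (supp h') (q h') k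
  else 0.

(** Given that u falls in the interval of h, its rescaled position there is again
    uniform in [0, 1[, so that one uniform variable feeds all the draws. *)
Definition next_draw (h : seq D) (u : R) : D :=
  pick_weighted k0 (supp h) (q h) ((u - cyl_left h) / cyl_width h).

Fixpoint expansion (n : nat) (u : R) : seq D :=
  if n is m.+1 then next_draw (expansion m u) u :: expansion m u else [::].

Definition interval_draw (n : nat) (u : measurableTypeR R) : D :=
  next_draw (expansion n u) u.

Lemma history_interval_draw n u : history interval_draw n u = expansion n u.
Proof. by elim: n => //= n ->. Qed.

(** The weights outside of the supports are arbitrary, so [cyl_left] and
    [cyl_width] describe events only for histories drawn from the supports. *)
Fixpoint admissible (h : seq D) : bool :=
  if h is k :: h' then (k \in supp h') && admissible h' else true.

Lemma admissible_expansion n u : admissible (expansion n u).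
Proof.
elim: n => //= n ->; rewrite andbT; apply: pick_weighted_mem.
by apply: contra_eq_neq (q_sum1 (expansion n u)) => ->;
  rewrite big_nil eq_sym oner_eq0.
Qed.

Lemma cyl_width_ge0 h : 0 <= cyl_width h.
Proof. by elim: h => //= k h IH; rewrite mulr_ge0. Qed.

(** The interval of a history contains those of its continuations. *)
Lemma cyl_le h k : k \in supp h ->
  cyl_left h <= cyl_left (k :: h) /\
  cyl_left (k :: h) + cyl_width (k :: h) <= cyl_left h + cyl_width h.
Proof.
move=> ks; have w0 := cyl_width_ge0 h; split => /=.
  by rewrite lerDl mulr_ge0 // offset_ge0.
rewrite -addrA lerD2l -mulrDr -[leRHS]mulr1 ler_wpM2l // -(q_sum1 h).
exact: offset_le.
Qed.

Lemma cyl_bounds h : admissible h ->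
  0 <= cyl_left h /\ cyl_left h + cyl_width h <= 1.
Proof.
elim: h => [|k h IH] /=; first by rewrite add0r.
case/andP => ks /IH[l0 r1]; have [l r] := cyl_le ks.
by split; [exact: le_trans l|exact: le_trans r1].
Qed.

Lemma expansion_eq h u : 0 <= u < 1 -> admissible h ->
  expansion (size h) u = h <-> cyl_left h <= u < cyl_left h + cyl_width h.
Proof.
move=> u01; elim: h => [|k h IH]; first by rewrite /= add0r.
case/andP => ks hadm; have {}IH := IH hadm.
have [l r] := cyl_le ks.
suff E : cyl_left h <= u < cyl_left h + cyl_width h ->
    next_draw h u = k <->
    cyl_left (k :: h) <= u < cyl_left (k :: h) + cyl_width (k :: h).
  split => [[ek eh]|/andP[lu ur]].
    by apply: (E (IH.1 eh)).1; rewrite -[h in next_draw h]eh.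
  have uh : cyl_left h <= u < cyl_left h + cyl_width h.
    by rewrite (le_trans l lu) (lt_le_trans ur r).
  have eh := (IH.2 uh); rewrite /= eh; congr (_ :: _).
  by apply: (E uh).2; rewrite lu ur.
move=> /andP[lu ur].
have w0 : 0 < cyl_width h by rewrite -(ltrD2l (cyl_left h)) addr0 (le_lt_trans lu ur).
rewrite /next_draw pick_weighted_eq //=; last first.
  by rewrite q_sum1 divr_ge0 ?subr_ge0 ?(ltW w0) // ltr_pdivrMr // mul1r ltrBlDl.
rewrite ler_pdivlMr // ltr_pdivrMr // lerBrDl ltrBlDl -addrA -mulrDr.
by rewrite ![cyl_width h * _]mulrC.
Qed.

Lemma measurable_expansion n h : measurable [set u : R | expansion n u = h].
Proof.
have m0 (S : set R) : (forall u, ~ S u) -> measurable S.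
  by move=> S0; rewrite (_ : S = set0) //; apply/seteqP; split.
elim: n h => [|n IH] [|k h] /=; try by apply: m0.
  by rewrite (_ : [set _ | _] = setT) //; apply/seteqP; split.
rewrite (_ : [set _ | _] =
    [set u | expansion n u = h] `&`
    (fun u => (u - cyl_left h) / cyl_width h) @^-1`
      [set x | pick_weighted k0 (supp h) (q h) x = k]).
  apply: measurableI => //; rewrite -[X in measurable X]setTI.
  have mf : measurable_fun setT (fun u : R => (u - cyl_left h) / cyl_width h).
    by apply: measurable_funM => //; exact: measurable_funB.
  by apply: mf => //; exact: measurable_pick_weighted.
apply/seteqP; split => u /=; first by move=> [<- <-].
by move=> [-> <-].
Qed.

Let P : probability (measurableTypeR R) R := @unit_interval_prob R.

Lemma expansion_prob h : admissible h ->
  P [set u | expansion (size h) u = h] = (cyl_width h)%:E.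
Proof.
move=> hadm; have [l0 r1] := cyl_bounds hadm.
apply: (unit_interval_prob_itv l0) => //; first exact: cyl_width_ge0.
by move=> u u01; exact: expansion_eq.
Qed.

(** The event is a finite disjoint union of intervals, one for each continuation
    of h that satisfies g, and each of them has the length of the interval of h
    times its weight. *)
Lemma expansion_step n h (g : pred D) :
  P ([set u | expansion n u = h] `&` [set u | g (interval_draw n u)]) =
  ((\sum_(k <- supp h | g k) q h k)%:E * P [set u | expansion n u = h])%E.
Proof.
have [hE|hE] := pselect (exists u, expansion n u = h); last first.
  have -> : [set u | expansion n u = h] = set0.
    by apply/seteqP; split => // u uh; apply: hE; exists u.
  by rewrite set0I !measure0 mule0.
case: hE => u0 hu0.
have hadm : admissible h by rewrite -hu0 admissible_expansion.
have {u0 hu0} hn : size h = n.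
  by rewrite -hu0 -history_interval_draw size_history.
have -> : [set u | expansion n u = h] `&` [set u | g (interval_draw n u)] =
    [set u | expansion n.+1 u \in [seq k :: h | k <- supp h & g k]].
  apply/seteqP; split => u /=.
    move=> [<- gu]; apply: map_f; rewrite mem_filter gu /=.
    by have /= := admissible_expansion n.+1 u => /andP[].
  by case/mapP => k; rewrite mem_filter /interval_draw => /andP[gk _] [-> ->].
rewrite -[in RHS]hn expansion_prob // -EFinM mulr_suml -big_filter.
have ss : {subset [seq k <- supp h | g k] <= supp h}
  by exact: mem_subseq (filter_subseq _ _).
have su : uniq [seq k <- supp h | g k] by rewrite filter_uniq.
elim: [seq k <- supp h | g k] ss su => [|k s IH] ss su.
  rewrite big_nil (_ : [set _ | _] = set0) ?measure0 //.
  by apply/seteqP; split.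
rewrite big_cons EFinD -IH; first last.
- by case/andP: su.
- by move=> j js; apply: ss; rewrite inE js orbT.
have kadm : admissible (k :: h) by rewrite /= ss ?inE ?eqxx.
rewrite mulrC -[(_ * _)%:E](expansion_prob kadm) [size _]/= hn -measureU //.
- congr (P _); apply/seteqP; split => u; rewrite /= inE.
    by case/orP => [/eqP|]; [left|right].
  by case=> [->|->]; rewrite ?eqxx ?orbT.
- exact: measurable_expansion.
- rewrite (_ : [set _ | _] =
    \big[setU/set0]_(j <- s) [set u | expansion n.+1 u = j :: h]).
    by apply: bigsetU_measurable => j _; exact: measurable_expansion.
  rewrite -bigcup_seq; apply/seteqP; split => u.
    by case/mapP => j js e; exists j.
  by case=> j js e; apply/mapP; exists j.
- apply/seteqP; split => // u [/= -> /mapP[j js [e]]].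
  by case/andP: su; rewrite e js.
Qed.

Lemma interval_draw_law :
  has_law P supp q (interval_draw : nat -> measurableTypeR R -> D).
Proof.
have E n h : [set t | history interval_draw n t = h] = [set t | expansion n t = h].
  by apply/seteqP; split => t /=; rewrite history_interval_draw.
split=> n h; first by rewrite E; exact: measurable_expansion.
by move=> g; rewrite E expansion_step.
Qed.

End Draws.

Lemma exists_draws (R : realType) (D : choiceType) (k0 : D)
    (supp : seq D -> seq D) (q : seq D -> D -> R) :
    (forall h, uniq (supp h)) -> (forall h k, 0 <= q h k) ->
    (forall h, \sum_(k <- supp h) q h k = 1) ->
  exists (disp : measure_display) (T : measurableType disp)
         (P : probability T R) (draw : nat -> T -> D),
    has_law P supp q draw.
Proof.
move=> u0 q0 q1; exists _, (measurableTypeR R), (@unit_interval_prob R).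
by exists (interval_draw k0 supp q); exact: interval_draw_law.
Qed.

(** * Frog processes driven by a sequence of draws *)

Lemma remove_frogs0 d (c : config d) : remove_frogs fset0 c = c.
Proof.
case: c => f v; rewrite /remove_frogs /=; congr Config.
rewrite (_ : [fmap _ : _ => _]%fmap = [fmap]%fmap) ?catf0 //.
by apply/fmapP => x; rewrite !not_fnd // in_fset0.
Qed.

Section HistoryEvents.
Variables (R : realType) (disp : measure_display) (T : measurableType disp).
Variables (P : probability T R) (D : countType).
Variables (supp : seq D -> seq D) (q : seq D -> D -> R) (draw : nat -> T -> D).
Hypothesis law : has_law P supp q draw.

Let hist := history draw.

(** Histories are numbered by [choice.pickle] so that an event about the history is
    a disjoint union indexed by the natural numbers. *)
Let atom n (A : set (seq D)) (m : nat) : set T :=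
  [set t | A (hist n t) /\ choice.pickle (hist n t) = m].

Let atomP n A m : (exists2 h, atom n A m = [set t | hist n t = h] & A h) \/
  atom n A m = set0.
Proof.
have [[h Ah hm]|nh] := pselect (exists2 h, A h & choice.pickle h = m); [left|right].
  exists h => //; apply/seteqP; split => t; rewrite /atom /=.
    by move=> [_]; rewrite -hm; exact: (pcan_inj choice.pickleK).
  by move=> ->.
by apply/seteqP; split => // t [At tm]; apply: nh; exists (hist n t).
Qed.

Let bigcup_atom n A : hist n @^-1` A = \bigcup_m atom n A m.
Proof.
by apply/seteqP; split => t; [move=> At; exists (choice.pickle (hist n t))|case=> m _ []].
Qed.

Let measurable_atom n A m : measurable (atom n A m).
Proof. by have [[h -> _]|->//] := atomP n A m; exact: law.1. Qed.

Lemma measurable_history n (A : set (seq D)) : measurable (history draw n @^-1` A).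
Proof. by rewrite bigcup_atom; exact: bigcupT_measurable. Qed.

(** If the conditional probability of g has the same value r at all histories in A,
    this is the conditional probability given A: sum over the histories. *)
Lemma history_event_law n (A : set (seq D)) (g : seq D -> pred D) (r : R) :
    (forall h, A h -> \sum_(k <- supp h | g h k) q h k = r) -> 0 <= r ->
  P (history draw n @^-1` A `&` [set t | g (history draw n t) (draw n t)]) =
  (r%:E * P (history draw n @^-1` A))%E.
Proof.
move=> Ar r0; rewrite [history draw n @^-1` A]bigcup_atom setI_bigcupl.
have tr : trivIset setT (atom n A) by move=> i j _ _ [t [[_ <-] [_ <-]]].
have mG m : measurable (atom n A m `&` [set t | g (hist n t) (draw n t)]).
  apply: measurableI => //.
  rewrite (_ : [set t | _] = history draw n.+1 @^-1`
    [set h | if h is k :: h' then g h' k else false]) //.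
  exact: measurable_history.
rewrite !measure_bigcup //; last exact: trivIset_setIr.
rewrite -nneseriesZl //; apply: eq_eseriesr => m _.
have [[h hE Ah]|->] := atomP n A m; last by rewrite set0I measure0 mule0.
rewrite hE -(Ar h Ah) -law.2; congr (P _).
by apply/seteqP; split => t /= [] ht gt; split => //; move: gt; rewrite [history draw n t]ht.
Qed.

End HistoryEvents.

(** Nothing is culled between steps: the only early removals in the coupling are
    interceptions. *)
Definition driven_process (T D : Type) (draw : nat -> T -> D) (d : nat)
    (att : seq D -> D -> attempt_type d) (kill : seq D -> D -> bool) :
    frog_process d T :=
  FrogProcess (fun _ _ => fset0)
    (fun n t => att (history draw n t) (draw n t))
    (fun n t => kill (history draw n t) (draw n t)).

Section DrivenProcess.
Variables (T D : Type) (draw : nat -> T -> D) (d : nat).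
Variables (att : seq D -> D -> attempt_type d) (kill : seq D -> D -> bool).
Variable cfg : seq D -> config d.
Hypothesis cfg0 : cfg [::] = init_config d.
Hypothesis cfgS : forall h k, cfg (k :: h) = advance (att h k) (kill h k) (cfg h).

Let X := driven_process draw att kill.

Lemma driven_config_at n t : config_at X n t = cfg (history draw n t).
Proof. by elim: n => //= n ->; rewrite remove_frogs0 cfgS. Qed.

Lemma driven_culled_config n t : culled_config X n t = cfg (history draw n t).
Proof. by rewrite /culled_config remove_frogs0 driven_config_at. Qed.

End DrivenProcess.

Lemma rho_ge0 (R : realType) (p : R) : 0 <= p -> 0 <= rho p.
Proof.
by move=> p0; rewrite /rho; case: ifP => // p2; apply: divr_ge0 => //; lra.
Qed.

Lemma rho_le1 (R : realType) (p : R) : rho p <= 1.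
Proof.
by rewrite /rho; case: ifP => // p2; rewrite ler_pdivrMr; lra.
Qed.

Lemma move_prob_ge0 (R : realType) d (p : R) b (m : option 'I_d) :
  0 <= p -> 0 <= move_prob p b m.
Proof.
move=> p0; case: m => [i|] /=; last by case: b; rewrite ?rho_ge0.
by apply: divr_ge0 => //; case: b; rewrite // subr_ge0 rho_le1.
Qed.

Lemma attempt_prob_ge0 (R : realType) d (p : R) (c : config d) a :
  0 <= p -> 0 <= attempt_prob p c a.
Proof.
move=> p0; case: a => [[v m]|] //=.
case: (_.[? v]%fmap) => [[x b|]|] //.
by rewrite mulr_ge0 ?invr_ge0 // move_prob_ge0.
Qed.

(** The filtration is generated by the draws.  Interceptions may look at the
    current draw, which is not revealed before the step. *)
Lemma driven_modified_rfm (R : realType) (disp : measure_display)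
    (T : measurableType disp) (P : probability T R) (D : countType)
    (supp : seq D -> seq D) (q : seq D -> D -> R) (draw : nat -> T -> D)
    (d : nat) (p : R) (att : seq D -> D -> attempt_type d)
    (kill : seq D -> D -> bool) (cfg : seq D -> config d) :
    0 <= p -> has_law P supp q draw -> cfg [::] = init_config d ->
    (forall h k, cfg (k :: h) = advance (att h k) (kill h k) (cfg h)) ->
    (forall h a, \sum_(k <- supp h | att h k == a) q h k =
                 attempt_prob p (cfg h) a) ->
  is_modified_rfm P p (driven_process draw att kill).
Proof.
move=> p0 law cfg0 cfgS attE.
pose F n : set (set T) := [set E | exists A, E = history draw n @^-1` A].
exists F; split.
- move=> n; split; last by move=> E [A ->]; exact: measurable_history law _ _.
  split; first by exists set0; rewrite preimage_set0.
    by move=> _ [A ->]; exists (~` A); rewrite setTD.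
  move=> E /choice[A AE]; exists (\bigcup_k A k).
  by rewrite preimage_bigcup; apply: eq_bigcup.
- move=> n _ [A ->]; exists [set h | A (behead h)].
  by apply/seteqP; split.
- by move=> n S; exists [set h | fset0 = S].
- split=> n b.
    by exists [set h | if h is k :: h' then att h' k = b else False].
  by exists [set h | if h is k :: h' then kill h' k = b else False].
- move=> n _ c a [A ->].
  (* The configuration is a function of the history, so conditioning on it
     restricts the set of histories. *)
  have -> : [set t | culled_config (driven_process draw att kill) n t = c] =
      history draw n @^-1` [set h | cfg h = c].
    by apply/seteqP; split => t /=; rewrite (driven_culled_config _ cfg0 cfgS).
  rewrite -preimage_setI.
  have -> : [set t | attempt (driven_process draw att kill) n t = a] =
      [set t | att (history draw n t) (draw n t) == a].
    by apply/seteqP; split => t /= /eqP.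
  apply: (@history_event_law _ _ _ _ _ _ _ _ law n _ (fun h k => att h k == a)).
    by move=> h [_ <-]; exact: attE.
  exact: attempt_prob_ge0.
Qed.

(** * The two moves read off a draw have the right laws *)

Section MoveSums.
Variables (R : realType) (d : nat) (p : R).
Hypothesis d_gt0 : (0 < d)%N.

(** The label [ord_max] is the spare one; it leaves the choice of the child to the
    independent uniform label i. *)
Definition small_move (k : option 'I_d.+1) (i : 'I_d) : option 'I_d :=
  omap (fun k => odflt i (unlift ord_max k)) k.

Let d_neq0 : d%:R != 0 :> R.
Proof. by rewrite pnatr_eq0 -lt0n. Qed.

Let sum_div (A : R) : \sum_(i < d) (A / d%:R) = A.
Proof. by rewrite sumr_const card_ord -[LHS]mulr_natr divfK. Qed.

Lemma sum_option (e : nat) (F : option 'I_e -> R) :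
  \sum_k F k = F None + \sum_(i < e) F (Some i).
Proof.
rewrite (bigD1 None) //=; congr (_ + _).
by rewrite (reindex_omap Some id) //=; [apply: eq_bigl => i; rewrite eqxx|case].
Qed.

Lemma sum_move_prob e b : (0 < e)%N ->
  \sum_(m : option 'I_e) move_prob p b m = 1.
Proof.
move=> e0; rewrite sum_option /= sumr_const card_ord -[X in _ + X]mulr_natr divfK.
  by case: b; rewrite ?add0r // addrC subrK.
by rewrite pnatr_eq0 -lt0n.
Qed.

(** The law of a move gives the same weight to all children. *)
Lemma sum_relabelled_move b (s : {perm 'I_d.+1}) m :
  \sum_(z : option 'I_d.+1 * 'I_d | omap s z.1 == m) (move_prob p b z.1 / d%:R)
  = move_prob p b m.
Proof.
transitivity (\sum_(k | omap s k == m) \sum_(i < d) (move_prob p b k / d%:R)).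
  by rewrite pair_big; apply: eq_bigl => z; rewrite andbT.
under eq_bigr do rewrite sum_div.
rewrite (big_pred1 (omap (s^-1)%g m)); first by case: m.
case=> [k|]; case: m => [j|] //=; rewrite ?(inj_eq Some_inj).
by rewrite -(inj_eq (@perm_inj _ s^-1%g)) permK.
Qed.

(** With A the probability to move away, the j-th child gets A/(d+1) from its own
    label and A/(d+1) * 1/d from the spare label, in total A/d. *)
Lemma sum_small_move b m :
  \sum_(z : option 'I_d.+1 * 'I_d | small_move z.1 z.2 == m)
    (move_prob p b z.1 / d%:R) = move_prob p b m.
Proof.
transitivity (\sum_k \sum_(i | small_move k i == m) (move_prob p b k / d%:R)).
  by rewrite pair_big_dep.
rewrite sum_option (bigD1_ord ord_max) //=.
rewrite unlift_none /=.
under [X in _ + (_ + X)]eq_bigr do rewrite liftK /=.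
case: m => [j|] /=; last first.
  by rewrite sum_div big_pred0 // big1 ?addr0.
rewrite big_pred0 // add0r (big_pred1 j) //.
rewrite (bigD1 j) //= [X in _ + (_ + X)]big1 => [|i ij]; last first.
  by rewrite big_pred0 // => i'; rewrite (inj_eq Some_inj) (negbTE ij).
rewrite eqxx sum_div addr0 -[d.+1]addn1 natrD.
have : d%:R + 1 != 0 :> R by rewrite natr1 pnatr_eq0.
by move: (if b then _ else _) d_neq0 => A; move=> *; field; apply/andP; split.
Qed.

End MoveSums.

(** * The law of a draw and its two marginals *)

Lemma mem_awake d (c : config d) v :
  (v \in awake c) = if (frogs c).[? v]%fmap is Some s then is_awake s else false.
Proof.
by rewrite /awake in_fset /= inE; case: fndP.
Qed.

Definition moving_away d (c : config d) (v : vertex d) : bool :=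
  if (frogs c).[? v]%fmap is Some (Awake _ b) then b else false.

Lemma attempt_probE (R : realType) d (p : R) (c : config d) v m :
  attempt_prob p c (Some (v, m)) =
  if v \in awake c then #|` awake c|%:R^-1 * move_prob p (moving_away c v) m else 0.
Proof. by rewrite /= mem_awake /moving_away; case: (_.[? v]%fmap) => [[]|]. Qed.

(** The sampled small frog, its label among d+1 (or the step to the parent), and
    the label among d that replaces the spare one; None if no frog is awake. *)
Definition draw_type d := option (vertex d * (option 'I_d.+1 * 'I_d)).

Definition draw_support d (c : config d) : seq (draw_type d) :=
  None :: [seq Some (v, z) | v <- enum_fset (awake c),
                             z <- enum {: option 'I_d.+1 * 'I_d}].

Definition draw_weight (R : realType) d (p : R) (c : config d) (r : draw_type d) : R :=
  match r with
  | None => (awake c == fset0)%:R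
  | Some (v, (k, i)) =>
      #|` awake c|%:R^-1 * (move_prob p (moving_away c v) k / d%:R)
  end.

Lemma draw_support_uniq d (c : config d) : uniq (draw_support c).
Proof.
rewrite /= allpairs_uniq ?enum_uniq ?fset_uniq //= ?andbT.
  by apply/negP => /allpairsP[[v z] []].
by move=> [v z] [v' z'] _ _ [-> ->].
Qed.

Lemma draw_weight_ge0 (R : realType) d (p : R) (c : config d) r :
  0 <= p -> 0 <= draw_weight p c r.
Proof.
move=> p0; case: r => [[v [k i]]|] //=.
by rewrite mulr_ge0 ?invr_ge0 // divr_ge0 // move_prob_ge0.
Qed.

Lemma sum_draw_weight (R : realType) d (p : R) (c : config d) (g : pred (draw_type d)) :
  \sum_(r <- draw_support c | g r) draw_weight p c r =
  (g None && (awake c == fset0))%:R +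
  \sum_(v <- awake c) #|` awake c|%:R^-1 *
    \sum_(z | g (Some (v, z))) (move_prob p (moving_away c v) z.1 / d%:R).
Proof.
rewrite /draw_support big_mkcond big_cons; congr (_ + _); first by case: (g None).
rewrite big_allpairs_dep; apply: eq_bigr => v _.
rewrite big_enum -big_mkcond mulr_sumr /=.
by apply: eq_bigr => -[k i] _.
Qed.

Lemma sum_draw_weight1 (R : realType) d (p : R) (c : config d) : (0 < d)%N ->
  \sum_(r <- draw_support c) draw_weight p c r = 1.
Proof.
move=> d0; have mp1 v : \sum_(z : option 'I_d.+1 * 'I_d)
    (move_prob p (moving_away c v) z.1 / d%:R) = 1.
  transitivity (\sum_(k : option 'I_d.+1) \sum_(i < d)
    (move_prob p (moving_away c v) k / d%:R)).
    by rewrite pair_big.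
  rewrite -[RHS](sum_move_prob p (moving_away c v) (ltn0Sn d)); apply: eq_bigr => k _.
  by rewrite sumr_const card_ord -[LHS]mulr_natr divfK // pnatr_eq0 -lt0n.
rewrite sum_draw_weight /=; under eq_bigr do rewrite mp1 mulr1.
rewrite big_const_seq count_predT iter_addr_0 -[X in _ + X]mulr_natr.
case: eqVneq => [->|n0]; first by rewrite cardfs0 mulr0 addr0.
by rewrite mulVf ?add0r // pnatr_eq0 cardfs_eq0.
Qed.

(** The map psi, which renames frogs, will be the identity for the small process
    and the embedding for the large one; mv turns a drawn label into a move.
    Since psi is a bijection between the awake frogs of both configurations,
    sampling is uniform in c' because it is in c. *)
Lemma draw_marginal (R : realType) d e (p : R) (c : config d) (c' : config e)
    (psi : vertex d -> vertex e)
    (mv : vertex d -> option 'I_d.+1 * 'I_d -> option 'I_e) a :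
    injective psi -> awake c' = [fset psi v | v in awake c]%fset ->
    {in awake c, forall v, moving_away c' (psi v) = moving_away c v} ->
    (forall v b m, \sum_(z | mv v z == m) (move_prob p b z.1 / d%:R)
                   = move_prob p b m) ->
  \sum_(r <- draw_support c | omap (fun vz => (psi vz.1, mv vz.1 vz.2)) r == a)
    draw_weight p c r = attempt_prob p c' a.
Proof.
move=> psi_inj aw' fl' mvE; rewrite sum_draw_weight.
have ac' : #|` awake c'| = #|` awake c| by rewrite aw' card_imfset.
have ae' : (awake c' == fset0) = (awake c == fset0) by rewrite -!cardfs_eq0 ac'.
case: a => [[u m]|] /=; last first.
  rewrite ae' big1 ?addr0 // => v _.
  by rewrite big_pred0 ?mulr0.
rewrite [RHS]attempt_probE add0r ac' aw'; case: imfsetP => /= [[v vA ->]|nv].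
  rewrite (bigD1_seq v) ?fset_uniq //= [X in _ + X]big1 ?addr0 => [|w wv].
    rewrite fl' // -(mvE v); congr (_ * _).
    by apply: eq_bigl => z; rewrite (inj_eq Some_inj) xpair_eqE eqxx.
  rewrite big_pred0 ?mulr0 // => z.
  by rewrite (inj_eq Some_inj) xpair_eqE (inj_eq psi_inj) (negbTE wv).
rewrite big_seq big1 // => v vA; rewrite big_pred0 ?mulr0 // => z.
rewrite (inj_eq Some_inj) xpair_eqE; case: eqP => // uv.
by case: nv; exists v.
Qed.

(** * Copies of a configuration in a larger tree *)

Section Embedding.
Variable d : nat.
Implicit Types (x y v : vertex d).

Definition labelling := vertex d -> {perm 'I_d.+1}.
Implicit Type pi : labelling.

Fixpoint embed pi x : vertex d.+1 :=
  if x is i :: y then pi y (lift ord_max i) :: embed pi y else [::].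

Lemma embed_inj pi : injective (embed pi).
Proof.
elim=> [|i x IH] [|j y] //= [e /IH xy]; move: e; rewrite xy.
by move=> /perm_inj/lift_inj ->.
Qed.

(** In the product of permutations the left factor acts first. *)
Definition swap_spare pi x (i : 'I_d) : labelling := fun y =>
  if y == x then (tperm (lift ord_max i) ord_max * pi y)%g else pi y.

(** The exchange affects only the images of the i-th child of x and of its
    descendants, and all of these are outside A as soon as the child is. *)
Lemma swap_spare_outside pi x i (A : {fset vertex d}) :
    (forall j y, j :: y \in A -> y \in A) -> i :: x \notin A ->
  {in A, embed (swap_spare pi x i) =1 embed pi}.
Proof.
move=> closed ixA; elim=> //= j y IH jyA; rewrite IH ?(closed _ _ jyA) //.
congr (_ :: _); rewrite /swap_spare; case: eqVneq => // yx.
rewrite permM tpermD // ?neq_lift // (inj_eq lift_inj).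
by apply: contraNneq ixA => ->; rewrite -yx.
Qed.

Definition relabel_state (phi : vertex d -> vertex d.+1) (s : frog_state d) :
    frog_state d.+1 :=
  if s is Awake x b then Awake (phi x) b else Removed.

(** The properties of reachable configurations that the coupling needs; together
    they say that everything that happens takes place on the visited subtree,
    where the embedding no longer changes. *)
Record well_formed (c : config d) : Prop := WellFormed {
  dom_visited : domf (frogs c) = visited c;
  visited_parent : forall i x, i :: x \in visited c -> x \in visited c;
  awake_visited : forall v x b,
    (frogs c).[? v]%fmap = Some (Awake x b) -> x \in visited c
}.

Record mirrors (phi : vertex d -> vertex d.+1)
    (c : config d) (c' : config d.+1) : Prop := Mirrors {
  mirror_frogs : forall v,
    (frogs c').[? phi v]%fmap = omap (relabel_state phi) (frogs c).[? v]%fmap;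
  mirror_visited : visited c' = [fset phi v | v in visited c]%fset;
  mirror_dom : domf (frogs c') = visited c'
}.

(** A mirrored configuration involves phi on visited vertices only. *)
Lemma mirrors_eq_in (phi psi : vertex d -> vertex d.+1)
    (c : config d) (c' : config d.+1) :
    well_formed c -> injective phi -> injective psi ->
    {in visited c, psi =1 phi} -> mirrors phi c c' -> mirrors psi c c'.
Proof.
move=> wf phi_inj psi_inj E [mf mv md].
have mv' : visited c' = [fset psi v | v in visited c]%fset.
  by rewrite mv; apply: eq_in_imfset => // v /= /E.
split=> // v; have [vc|vc] := boolP (v \in visited c).
  rewrite E // mf; case fv: (frogs c).[? v]%fmap => [[x b|]|] //=.
  by rewrite E // (awake_visited wf fv).
rewrite !not_fnd //; first by rewrite -(dom_visited wf) in vc.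
rewrite -[_ \notin _]/(psi v \notin domf (frogs c')) md mv'.
by apply/imfsetP => -[w /= wc /psi_inj vw]; rewrite vw wc in vc.
Qed.

Lemma fnd_wake e (y v : vertex e) (f : {fmap vertex e -> frog_state e}) :
  ((wake y f).[? v])%fmap =
  if (v == y) && (y \notin domf f) then Some (Awake y false) else f.[? v]%fmap.
Proof.
by rewrite /wake; case: ifP => yf; rewrite ?andbF //= andbT fnd_set.
Qed.

Lemma domf_wake e (y : vertex e) (f : {fmap vertex e -> frog_state e}) :
  domf (wake y f) = (y |` domf f)%fset.
Proof.
rewrite /wake; case: ifP => yf; last by rewrite dom_setf.
by apply/fsetP => z; rewrite in_fset1U; case: eqP => // ->.
Qed.

Lemma destination_visited (c : config d) x m :
  well_formed c -> x \in visited c -> forall i y,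
  i :: y = destination x m -> y \in visited c.
Proof.
move=> wf xc i y; case: m => [j|] /= [].
  by move=> _ ->.
by case: x xc => //= j x /(visited_parent wf) xc e;
  rewrite -e in xc; exact: visited_parent xc.
Qed.

Section Advance.
Variables (phi : vertex d -> vertex d.+1) (c : config d) (c' : config d.+1).
Hypothesis phi_inj : injective phi.
Hypothesis phi_root : phi [::] = [::].
Hypothesis wf : well_formed c.
Hypothesis mir : mirrors phi c c'.

Lemma mirror_mem v : (phi v \in visited c') = (v \in visited c).
Proof. by rewrite (mirror_visited mir) mem_imfset. Qed.

Lemma mirror_mem_dom v : (phi v \in domf (frogs c')) = (v \in domf (frogs c)).
Proof. by rewrite (mirror_dom mir) (dom_visited wf) mirror_mem. Qed.

Lemma mirror_root v : (phi v == [::]) = (v == [::]).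
Proof. by rewrite -phi_root (inj_eq phi_inj). Qed.

Lemma mirror_awake : awake c' = [fset phi v | v in awake c]%fset.
Proof.
have E v : (phi v \in awake c') = (v \in awake c).
  by rewrite !mem_awake (mirror_frogs mir); case: (_.[? v])%fmap => [[]|].
apply/fsetP => u; apply/idP/imfsetP => /= [uA|[v vA ->]]; last by rewrite E.
have : u \in visited c'.
  rewrite -(mirror_dom mir) -fndSome; move: uA; rewrite mem_awake.
  by case: (_.[? u])%fmap.
rewrite (mirror_visited mir) => /imfsetP[v /= _ uv]; exists v => //.
by rewrite -E -uv.
Qed.

Lemma mirror_moving_away v : moving_away c' (phi v) = moving_away c v.
Proof. by rewrite /moving_away (mirror_frogs mir); case: (_.[? v])%fmap => [[]|]. Qed.

Variables (v x : vertex d) (b : bool).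
Hypothesis fv : (frogs c).[? v]%fmap = Some (Awake x b).

Let vc : v \in visited c.
Proof. by rewrite -(dom_visited wf) -fndSome fv. Qed.

Lemma advance_well_formed m : well_formed (advance (Some (v, m)) false c).
Proof.
have xc := awake_visited wf fv.
rewrite /advance fv; split; cbn [frogs visited].
- rewrite dom_setf domf_wake (dom_visited wf); apply/fsetP => z.
  by rewrite !in_fset1U; case: eqP => // ->; rewrite vc orbT.
- move=> i y; rewrite !in_fset1U => /orP[/eqP|/(visited_parent wf) ->];
    last by rewrite orbT.
  by move=> /(destination_visited wf xc) ->; rewrite orbT.
- move=> w y e; rewrite fnd_set in_fset1U.
  case: ifP => _; first by case: ifP => // _ [<- _]; rewrite eqxx.
  rewrite fnd_wake; case: ifP => _; first by move=> [<- _]; rewrite eqxx.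
  by move=> /(awake_visited wf) ->; rewrite orbT.
Qed.

(** All the rules of a step are expressed by destinations, by membership in the
    visited set and by equality with the root, which phi preserves. *)
Lemma advance_mirrors m m' :
    phi (destination x m) = destination (phi x) m' -> isSome m = isSome m' ->
  mirrors phi (advance (Some (v, m)) false c)
    (advance (Some (phi v, m')) false c').
Proof.
move=> dE mE; have fv' : (frogs c').[? phi v]%fmap = Some (Awake (phi x) b).
  by rewrite (mirror_frogs mir) fv.
rewrite /advance fv fv' -dE; split; cbn [frogs visited].
- move=> w; rewrite !fnd_set (inj_eq phi_inj); case: ifP => _.
    by rewrite mirror_root mirror_mem -mE; case: ifP.
  rewrite !fnd_wake (inj_eq phi_inj) mirror_mem_dom.
  by case: ifP => // _; rewrite (mirror_frogs mir).
- apply/fsetP => z; rewrite (mirror_visited mir) in_fset1U.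
  apply/orP/imfsetP => /= [[/eqP ->|/imfsetP[w /= wc ->]]|[w]].
  + by exists (destination x m); rewrite // in_fset1U eqxx.
  + by exists w; rewrite // in_fset1U wc orbT.
  + rewrite in_fset1U => /orP[/eqP -> ->|wc ->]; [by left|right].
    by apply/imfsetP; exists w.
- rewrite dom_setf domf_wake (mirror_dom mir); apply/fsetP => z.
  rewrite !in_fset1U; case: eqP => // ->.
  by rewrite mirror_mem vc orbT.
Qed.

Lemma root_arrival_mirror m m' :
    phi (destination x m) = destination (phi x) m' ->
  root_arrival (Some (phi v, m')) false c' = root_arrival (Some (v, m)) false c.
Proof.
by move=> dE; rewrite /root_arrival (mirror_frogs mir) fv /= -dE mirror_root.
Qed.

(** Landing on a visited site while moving away has no other effect than the
    removal of the frog, so it can be imitated by an interception. *)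
Lemma advance_onto_visited i : i :: x \in visited c ->
  advance (Some (v, Some i)) false c = advance (Some (v, Some i)) true c.
Proof.
move=> ixc; rewrite /= fv /wake (dom_visited wf) ixc /=; congr Config.
by apply/fsetP => z; rewrite in_fset1U; case: eqP => // ->.
Qed.

Lemma advance_killed_mirrors m m' :
  mirrors phi (advance (Some (v, m)) true c)
    (advance (Some (phi v, m')) true c').
Proof.
have fv' : (frogs c').[? phi v]%fmap = Some (Awake (phi x) b).
  by rewrite (mirror_frogs mir) fv.
rewrite /advance fv fv'; split; cbn [frogs visited].
- by move=> w; rewrite !fnd_set (inj_eq phi_inj); case: ifP => // _;
    rewrite (mirror_frogs mir).
- exact: mirror_visited mir.
- rewrite dom_setf (mirror_dom mir); apply/fsetP => z.
  by rewrite in_fset1U; case: eqP => // ->; rewrite mirror_mem vc.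
Qed.

End Advance.
End Embedding.

(** * The coupling *)

Section Coupling.
Variable d : nat.

Record coupled_state := CoupledState {
  small : config d;
  large : config d.+1;
  labels : labelling d
}.
Implicit Type s : coupled_state.

Definition position (c : config d) (v : vertex d) : vertex d :=
  if (frogs c).[? v]%fmap is Some (Awake x _) then x else [::].

Definition small_attempt (r : draw_type d) : attempt_type d :=
  omap (fun vz => (vz.1, small_move vz.2.1 vz.2.2)) r.

Definition large_attempt s (r : draw_type d) : attempt_type d.+1 :=
  omap (fun vz => (embed (labels s) vz.1,
                   omap (labels s (position (small s) vz.1)) vz.2.1)) r.

Definition picks_spare (r : draw_type d) : bool :=
  if r is Some (_, (Some k, _)) then k == ord_max else false.

(** The child that the small frog visits if the spare label is drawn. *)
Definition small_target s (r : draw_type d) : vertex d :=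
  if r is Some (v, (_, i)) then i :: position (small s) v else [::].

Definition blocked s (r : draw_type d) : bool :=
  picks_spare r && (small_target s r \in visited (small s)).

Definition next_labels s (r : draw_type d) : labelling d :=
  if r is Some (v, (k, i)) then
    if picks_spare r && ~~ blocked s r then
      swap_spare (labels s) (position (small s) v) i
    else labels s
  else labels s.

Definition step s (r : draw_type d) : coupled_state :=
  CoupledState (advance (small_attempt r) false (small s))
    (advance (large_attempt s r) (blocked s r) (large s))
    (next_labels s r).

Definition coupled s : Prop :=
  well_formed (small s) /\ mirrors (embed (labels s)) (small s) (large s).

Definition init_state : coupled_state :=
  CoupledState (init_config d) (init_config d.+1) (fun=> 1%g).

Lemma init_coupled : coupled init_state.
Proof.
split; split; rewrite /init_state /init_config; cbn [frogs visited small large labels].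
- by apply/fsetP => z; rewrite dom_setf in_fset1U in_fset0 orbF in_fset1.
- by move=> i x; rewrite !in_fset1.
- by move=> v x b; rewrite fnd_set fnd_fmap0; case: ifP => // _ [<- _]; rewrite in_fset1.
- move=> v; rewrite !fnd_set !fnd_fmap0.
  by case: v.
- by rewrite imfset_fset1.
- by apply/fsetP => z; rewrite dom_setf in_fset1U in_fset0 orbF in_fset1.
Qed.

(** This covers draws of a frog that is not awake.  Its position is then the root
    by default, and the labels may change there, but still only for an unvisited
    child. *)
Lemma next_labels_embed s r : well_formed (small s) ->
  {in visited (small s), embed (next_labels s r) =1 embed (labels s)}.
Proof.
move=> wf; case: r => [[v [k i]]|] //; rewrite /next_labels.
case: ifP => // /andP[ks]; rewrite /blocked ks /= => tN.
apply: swap_spare_outside tN.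
exact: visited_parent.
Qed.

(** The image of [embed] avoids spare children, so [mirrors] implies that they are
    unvisited.  This is why a blocked large frog has to be intercepted: the rules
    of the model would let it go on. *)
Lemma step_coupled s r : coupled s -> coupled (step s r) /\
  root_arrival (large_attempt s r) (blocked s r) (large s) =
  root_arrival (small_attempt r) false (small s).
Proof.
move=> [wf mir]; have E := @next_labels_embed s r wf.
have mir' : mirrors (embed (next_labels s r)) (small s) (large s).
  by apply: mirrors_eq_in mir => //; exact: embed_inj.
rewrite /coupled /step; cbn [small large labels].
case: r E mir' => [[v [k i]]|] E mir'; last by [].
case fv: (frogs (small s)).[? v]%fmap => [[x b|]|]; first last.
- by rewrite /= (mirror_frogs mir) fv /=.
- by rewrite /= (mirror_frogs mir) fv /=.
have vc : v \in visited (small s) by rewrite -(dom_visited wf) -fndSome fv.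
have xc := awake_visited wf fv.
have px : position (small s) v = x by rewrite /position fv.
have [bl|nbl] := boolP (blocked s (Some (v, (k, i)))).
  have -> : next_labels s (Some (v, (k, i))) = labels s by rewrite /= bl andbF.
  have [ks ixc] : k = Some ord_max /\ i :: x \in visited (small s).
    by move: bl; rewrite /blocked /= px; case: (k) => //= ? /andP[/eqP -> ->].
  rewrite ks.
  have -> : small_attempt (Some (v, (Some ord_max, i))) = Some (v, Some i).
    by rewrite /small_attempt /= unlift_none.
  split; last by rewrite /= (mirror_frogs mir) fv.
  split; first exact: (advance_well_formed wf fv).
  rewrite (advance_onto_visited wf fv ixc).
  by apply: (advance_killed_mirrors _ wf mir fv); exact: embed_inj.
(* The labels change before the frogs move: read with the new labels, a drawn
   spare label leads the large frog to the copy of the i-th child. *)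
set pi' := next_labels _ _ in E mir' *.
have dE : embed pi' (destination x (small_move k i)) =
    destination (embed pi' x) (omap (labels s x) k).
  case: k @pi' E nbl {mir'} => [k|] pi' E nbl /=; last by case: (x).
  case: unliftP => [j kE|kE] /=; congr (_ :: _).
    by rewrite /pi' /next_labels kE /picks_spare eq_sym (negbTE (neq_lift _ _)).
  rewrite /pi' /next_labels nbl kE /= eqxx px /= /swap_spare eqxx.
  by rewrite permM tpermL.
have -> : large_attempt s (Some (v, (k, i))) =
    Some (embed pi' v, omap (labels s x) k) by rewrite /large_attempt /= px E.
split; last exact: (root_arrival_mirror (embed_inj (pi := pi')) erefl mir' fv).
split; first exact: (advance_well_formed wf fv).
apply: (advance_mirrors (embed_inj (pi := pi')) erefl wf mir' fv) => //.
by case: (k).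
Qed.

End Coupling.

Theorem lemma7 (R : realType) (d : nat) (p : R)
    (hd : (1 <= d)%N) (hp0 : 0 <= p) (hp1 : p <= 1) :
  exists (disp : measure_display) (T : measurableType disp)
         (P : probability T R)
         (X : frog_process d T) (Y : frog_process d.+1 T),
    [/\ is_rfm P p X,
        is_modified_rfm P p Y
      & recurrent P X <-> recurrent P Y].
Proof.
pose run : seq (draw_type d) -> coupled_state d :=
  foldr (fun r s => step s r) (init_state d).
have runC h : coupled (run h).
  elim: h => [|r h IH]; first exact: init_coupled.
  exact: (step_coupled r IH).1.
have [disp [T [P [draw law]]]] := exists_draws (None : draw_type d)
  (fun h => draw_support_uniq (small (run h)))
  (fun h r => draw_weight_ge0 (small (run h)) r hp0)
  (fun h => sum_draw_weight1 p (small (run h)) hd).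
pose X := driven_process draw (fun _ => @small_attempt d) (fun _ _ => false).
pose Y := driven_process draw (fun h => large_attempt (run h)) (fun h => blocked (run h)).
have XE n t := @driven_culled_config _ _ draw _ (fun _ => @small_attempt d)
  (fun _ _ => false) (fun h => small (run h)) erefl (fun _ _ => erefl) n t.
have YE n t := @driven_culled_config _ _ draw _ (fun h => large_attempt (run h))
  (fun h => blocked (run h)) (fun h => large (run h)) erefl (fun _ _ => erefl) n t.
exists disp, T, P, X, Y; split.
- split=> //; apply: (driven_modified_rfm (cfg := fun h => small (run h)) hp0 law) => //.
  move=> h a; rewrite -(@draw_marginal _ _ _ p (small (run h)) (small (run h)) id
    (fun _ z => small_move z.1 z.2)) //.
  + by rewrite imfset_id.
  + by move=> v b m; exact: sum_small_move.
- apply: (driven_modified_rfm (cfg := fun h => large (run h)) hp0 law) => //.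
  move=> h a; have [wf mir] := runC h; set s := run h in wf mir *.
  apply: (draw_marginal (mv := fun v z => omap (labels s (position (small s) v)) z.1)).
  + exact: embed_inj.
  + exact: mirror_awake.
  + by move=> v _; exact: (mirror_moving_away mir).
  + by move=> v b m; exact: sum_relabelled_move.
- rewrite /recurrent.
  suff -> : root_arrival_at X = root_arrival_at Y by [].
  apply/funext => n; apply/funext => t.
  by rewrite /root_arrival_at XE YE (step_coupled _ (runC _)).2.
Qed.
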